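(* Let $M$ be a compact Riemannian manifold with normalized Lebesgue (Riemannian volume) measure $m$, $m(M)=1$, and let $f\colon M\to M$ be Borel measurable. For every $0<\alpha\le 1$ there exists a minimal $\alpha$-observable statistical attractor for $f$. Moreover, if $\alpha=1$, then the minimal $\alpha$-observable statistical attractor is unique.
   Context: For a nonempty compact set $K\subset M$, its basin of statistical attraction is $$B(K)=\Big\{x\in M:\ \lim_{n\to+\infty}\frac1n\,\#\{0\le j\le n-1:\ \mathrm{dist}(f^j(x),K)<\epsilon\}=1\ \ \forall\,\epsilon>0\Big\}.$$ A nonempty compact set $K$ with $m(B(K))>0$ is called a statistical attractor. For $0<\alpha\le1$, $K$ is $\alpha$-observable ($\alpha$-obs.) if $m(B(K))\ge\alpha$. It is minimal $\alpha$-observable if it is $\alpha$-observable and no proper nonempty compact subset of $K$ is $\alpha$-observable for the same value of $\alpha$. *)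

(* Defs.v *)
From HB Require Import structures.
From mathcomp Require Import all_boot all_order all_algebra.
From mathcomp Require Import all_classical all_reals all_analysis.

Set Implicit Arguments.
Unset Strict Implicit.
Unset Printing Implicit Defensive.

Import Order.TTheory GRing.Theory Num.Theory.
Import numFieldNormedType.Exports.

Local Open Scope classical_set_scope.
Local Open Scope ring_scope.

(* Measurable types of MathComp-Analysis are pointed, hence the join. *)
#[short(type="pmetricType")]
HB.structure Definition PointedMetric (R : numDomainType) :=
  {M of Metric R M & isPointed M}.

Notation borel M := (g_sigma_algebraType (@open M)).

Section smooth_maps.
Context {R : realType}.

Definition partial n (j : 'I_n) (h : 'rV[R]_n -> R) : 'rV[R]_n -> R :=
  fun x => 'D_(delta_mx 0 j) h x.

Fixpoint C_k n (k : nat) (O : set 'rV[R]_n) (h : 'rV[R]_n -> R) : Prop :=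
  (forall x, O x -> {for x, continuous h}) /\
  if k is k'.+1 then
    forall j : 'I_n, (forall x, O x -> derivable h x (delta_mx 0 j)) /\
                     C_k k' O (partial j h)
  else True.

Definition smooth_on n (O : set 'rV[R]_n) (h : 'rV[R]_n -> R) : Prop :=
  forall k, C_k k O h.

Definition smooth_map_on n p (O : set 'rV[R]_n) (g : 'rV[R]_n -> 'rV[R]_p) :=
  forall i : 'I_p, smooth_on O (fun x => g x 0 i).

End smooth_maps.

(* Integral over R^n with respect to Lebesgue measure, as an iterated
   one-dimensional integral; by Tonelli's theorem this is the usual integral
   for the nonnegative Borel functions to which it is applied below. *)
Fixpoint lebesgue_integral_Rn {R : realType} (n : nat) :
    ('rV[R]_n -> \bar R) -> \bar R :=
  match n with
  | 0 => fun h => h 0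
  | n'.+1 => fun h =>
      (\int[@lebesgue_measure R]_x
         lebesgue_integral_Rn
           (fun v : 'rV[R]_n' => h (row_mx (x : R)%:M v : 'rV[R]_(1 + n'))))%E
  end.

Section riemannian_manifolds.
Context {R : realType}.

(* [coord] and [param] are meaningful on [dom] and on [coord @` dom] only. *)
Record chart (M : Type) (n : nat) := Chart {
  dom : set M ;
  coord : M -> 'rV[R]_n ;
  param : 'rV[R]_n -> M }.

Definition codom_chart (M : Type) n (c : chart M n) : set 'rV[R]_n :=
  coord c @` dom c.

Definition is_chart (M : topologicalType) n (c : chart M n) : Prop :=
  [/\ open (dom c),
      open (codom_chart c),
      {in dom c, cancel (coord c) (param c)},
      forall p, dom c p -> {for p, continuous (coord c)} &
      forall x, codom_chart c x -> {for x, continuous (param c)}].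

(* An atlas with, at each point, a preferred chart around it, and the Gram
   matrix of a Riemannian metric in the coordinates of each chart. *)
Record riemannian_data (M : Type) (n : nat) := RiemannianData {
  chart_idx : Type ;
  charts : chart_idx -> chart M n ;
  chart_at : M -> chart_idx ;
  gram : chart_idx -> 'rV[R]_n -> 'M[R]_n }.

Section definitions.
Context {M : pmetricType R} {n : nat} (X : riemannian_data M n).
Implicit Types (i j : chart_idx X) (p q : M) (gamma : R -> M).

Definition overlap i j : set 'rV[R]_n :=
  coord (charts i) @` (dom (charts i) `&` dom (charts j)).

Definition transition i j : 'rV[R]_n -> 'rV[R]_n :=
  coord (charts j) \o param (charts i).

(* C^1 curves are restricted to [0, 1]. Corners can be reparametrized with zero
   velocity, so C^1 and piecewise C^1 curves have the same infimal length. *)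
Definition C1_curve gamma : Prop :=
  continuous gamma /\
  forall i t, dom (charts i) (gamma t) ->
    derivable (coord (charts i) \o gamma) t 1 /\
    {for t, continuous (derive1 (coord (charts i) \o gamma))}.

Definition speed gamma (t : R) : R :=
  let i := chart_at X (gamma t) in
  let v := derive1 (coord (charts i) \o gamma) t in
  Num.sqrt ((v *m gram i (coord (charts i) (gamma t)) *m v^T) 0 0).

Definition curve_length gamma : \bar R :=
  (\int[@lebesgue_measure R]_(t in `[0%R, 1%R]) (speed gamma t)%:E)%E.

(* +oo if no curve joins p to q. *)
Definition riemannian_dist p q : \bar R :=
  ereal_inf [set curve_length gamma | gamma in
    [set gamma | [/\ C1_curve gamma, gamma 0 = p & gamma 1 = q]]].

(* The distance of M is the Riemannian one between points of the same connected
   component; distances between components are only constrained by the topology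
   of M. Vectors are rows, so a tangent vector v in chart i is
   v *m 'J (transition i j) x in chart j. *)
Record is_riemannian_manifold : Prop := IsRiemannianManifold {
  charts_ok : forall i, is_chart (charts i) ;
  chart_at_dom : forall p, dom (charts (chart_at X p)) p ;
  transition_smooth : forall i j, smooth_map_on (overlap i j) (transition i j) ;
  gram_smooth : forall i (a b : 'I_n),
    smooth_on (codom_chart (charts i)) (fun x => gram i x a b) ;
  gram_sym : forall i x, codom_chart (charts i) x -> (gram i x)^T = gram i x ;
  gram_pos : forall i x (v : 'rV[R]_n), codom_chart (charts i) x -> v != 0 ->
    0 < (v *m gram i x *m v^T) 0 0 ;
  gram_compat : forall i j x, overlap i j x ->
    gram i x = 'J (transition i j) x *m gram j (transition i j x)
                 *m ('J (transition i j) x)^T ;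
  mdist_riemannian : forall p q, (riemannian_dist p q < +oo)%E ->
    (mdist p q)%:E = riemannian_dist p q }.

(* The probability m is c times the Riemannian volume, whose density in a chart
   is the square root of the Gram determinant; as m has total mass 1, this
   forces c to be the inverse of the volume of M. *)
Definition is_normalized_volume (m : probability (borel M) R) : Prop :=
  exists2 c : R, 0 < c &
    forall i (A : set (borel M)), measurable A -> A `<=` dom (charts i) ->
      m A = (c%:E * lebesgue_integral_Rn
        ((fun x => (Num.sqrt (\det (gram i x)))%:E) \_ (coord (charts i) @` A)))%E.

End definitions.
End riemannian_manifolds.

Section attractors.
Context {R : realType} {M : pmetricType R}.
Variables (m : probability (borel M) R) (f : M -> M).
Implicit Types (K : set M) (x : M) (alpha : R).

Definition dist_to K x : R := inf [set mdist x y | y in K].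

Definition visits K (eps : R) x (n : nat) : nat :=
  #|[pred j : 'I_n | dist_to K (iter j f x) < eps]|.

Definition basin K : set M :=
  [set x | forall eps : R, 0 < eps ->
    (fun n : nat => n%:R^-1 * (visits K eps x n)%:R) @ \oo --> (1 : R)].

Definition statistical_attractor K : Prop :=
  [/\ K !=set0, compact K & (0 < m (basin K))%E].

Definition observable alpha K : Prop :=
  [/\ K !=set0, compact K & (alpha%:E <= m (basin K))%E].

Definition minimal_observable alpha K : Prop :=
  observable alpha K /\
  forall K', K' !=set0 -> compact K' -> K' `<` K -> ~ observable alpha K'.

End attractors.

(* Main.v *)
Require Import Defs.
From HB Require Import structures.
From mathcomp Require Import all_boot all_order all_algebra.
From mathcomp Require Import all_classical all_reals all_analysis.
From mathcomp Require Import measurable_realfun.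

Set Implicit Arguments.
Unset Strict Implicit.
Unset Printing Implicit Defensive.

Import Order.TTheory GRing.Theory Num.Theory.
Import numFieldNormedType.Exports.

Local Open Scope classical_set_scope.
Local Open Scope ring_scope.

(* Whether x lies in the basin of K depends only on the orbit of x visiting each
   neighbourhood of K with asymptotic frequency 1. For existence, apply Zorn's
   lemma to the alpha-observable compact sets: by compactness, countably many
   members of a chain already enter every neighbourhood of its intersection K,
   so the basin of K contains the intersection of their basins, which has
   measure >= alpha by continuity from above. For uniqueness, two frequencies
   equal to 1 force joint visits of frequency 1, and points close to both K and
   L are close to K `&` L; hence K `&` L is again 1-observable and minimality
   identifies it with both K and L. *)

(** * Asymptotic visit frequencies along an orbit *)

Section frequency.
Context {R : realType} {T : Type} (f : T -> T).
Implicit Types (A B : set T) (x : T) (n : nat).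

Definition visit_freq A x n : R := n%:R^-1 * \sum_(j < n) \1_A (iter j f x).

Definition full_freq A : set T := [set x | visit_freq A x @ \oo --> (1 : R)].

Lemma visit_freq_le1 A x n : visit_freq A x n <= 1.
Proof.
rewrite /visit_freq; case: n => [|n]; first by rewrite big_ord0 mulr0.
rewrite ler_pdivrMl ?ltr0n// mulr1.
have -> : n.+1%:R = \sum_(j < n.+1) (1 : R) by rewrite sumr_const card_ord.
by apply: ler_sum => i _; rewrite indicE lern1 leq_b1.
Qed.

Lemma le_visit_freq A B x n : A `<=` B -> visit_freq A x n <= visit_freq B x n.
Proof.
move=> AB; apply: ler_wpM2l; first by rewrite invr_ge0.
apply: ler_sum => i _; rewrite !indicE ler_nat.
by case: (boolP (_ \in A)) => // /set_mem/AB/mem_set ->.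
Qed.

Lemma full_freqS A B : A `<=` B -> full_freq A `<=` full_freq B.
Proof.
move=> AB x; rewrite /full_freq/= => Ax.
apply: (squeeze_cvgr _ Ax); last exact: cvg_cst.
by apply: nearW => n; rewrite le_visit_freq// visit_freq_le1.
Qed.

Lemma full_freqT : full_freq setT = setT.
Proof.
apply/seteqP; split => // x _; apply/cvgrPdist_lt => e e0.
near=> n.
rewrite /visit_freq (eq_bigr (fun=> 1)); last by move=> i _; rewrite indicT.
rewrite sumr_const card_ord mulVf ?subrr ?normr0//.
by rewrite pnatr_eq0 -lt0n; near: n; exists 1%N.
Unshelve. all: by end_near. Qed.

Lemma full_freq0 : full_freq set0 = set0.
Proof.
apply/seteqP; split => // x; rewrite /full_freq/= => x1.
suff x0 : visit_freq set0 x @ \oo --> (0 : R).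
  have : 1 = 0 :> R.
    by rewrite -(cvg_lim (@Rhausdorff R) x1)// (cvg_lim (@Rhausdorff R) x0).
  by move/eqP; rewrite oner_eq0.
apply: cvg_near_cst; apply: nearW => n.
by rewrite /visit_freq big1 ?mulr0// => i _; rewrite indic0.
Qed.

(** Pointwise [\1_A + \1_B - 1 <= \1_(A]&[B)]; averaging squeezes the frequency of visits to [A]&[B]
    between a sequence tending to 1 and 1. *)
Lemma full_freqI A B : full_freq A `&` full_freq B `<=` full_freq (A `&` B).
Proof.
move=> x []; rewrite /full_freq/= => Ax Bx.
have ABx : visit_freq A x n + visit_freq B x n - 1 @[n --> \oo] --> (1 : R).
  by rewrite -[X in _ --> X](addrK 1); apply: cvgB; [exact: cvgD|exact: cvg_cst].
apply: (squeeze_cvgr _ ABx); last exact: cvg_cst.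
apply: nearW => n.
rewrite visit_freq_le1 andbT lerBlDr -mulrDr -big_split/=.
(* The constant 1 is replaced by an average of ones, to compare term by term; this is only an
   inequality because the average is 0 at [n = 0]. *)
have n1 : n%:R^-1 * \sum_(j < n) 1 <= 1 :> R.
  rewrite sumr_const card_ord; case: n => [|n]; first by rewrite mulr0.
  by rewrite mulVf// pnatr_eq0.
apply: le_trans (lerD (lexx _) n1).
rewrite -mulrDr -big_split/=; apply: ler_wpM2l; first by rewrite invr_ge0.
apply: ler_sum => i _; rewrite !indicE in_setI.
by do 2 case: (_ \in _); rewrite /= ?addr0 ?add0r.
Qed.

End frequency.

(** Frequencies never exceed 1, so convergence to 1 only asks that they eventually stay above
    [1 - k.+1%:R^-1] for every [k], a countable combination of measurable conditions. *)
Lemma measurable_full_freq {R : realType} d (T : measurableType d) (f : T -> T)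
    (A : set T) : measurable_fun setT f -> measurable A ->
  measurable (full_freq (R := R) f A).
Proof.
move=> mf mA.
have mfj j : measurable_fun setT (iter j f).
  elim: j => [|j IH]; first exact: measurable_id.
  exact: measurableT_comp.
have mfreq n : measurable_fun setT (fun x => visit_freq f A x n : R).
  apply: measurable_funM => //; apply: measurable_sum => j.
  by apply: measurableT_comp => //; exact: measurable_indic.
rewrite (_ : full_freq _ _ =
  \bigcap_k \bigcup_N \bigcap_(n in [set n | (N <= n)%N])
    ((fun x => visit_freq f A x n : R) @^-1` `]1 - k.+1%:R^-1, +oo[)).
  apply: bigcapT_measurable => k; apply: bigcupT_measurable => N.
  apply: bigcap_measurableType => n _.
  by rewrite -[X in measurable X]setTI; exact: mfreq.
apply/seteqP; split => x.
  rewrite /full_freq/= => x1 k _.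
  have [N _ Nx] : \forall n \near \oo, 1 - k.+1%:R^-1 < visit_freq f A x n :> R.
    by apply: cvgr_gt x1 _ _; rewrite ltrBlDr ltrDl invr_gt0.
  by exists N => // n Nn; rewrite /= in_itv/= andbT; exact: Nx.
move=> xA; rewrite /full_freq/=; apply/cvgrPdist_lt => e e0.
have [k ke] := ltr_add_invr e0.
have [N _ Nx] := xA k I; exists N => // n /= Nn.
rewrite ger0_norm ?subr_ge0 ?visit_freq_le1//.
have := Nx n Nn; rewrite /= in_itv/= andbT ltrBlDr -ltrBlDl => /lt_trans; apply.
by rewrite add0r in ke.
Qed.

(** * Metric neighbourhoods and compactness *)

Section thickening.
Context {R : realType} {M : pmetricType R}.
Implicit Types (K L : set M) (eps : R) (x : M).

Definition thickening K eps : set M :=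
  [set x | exists2 y, K y & mdist x y < eps].

(** Nonemptiness matters: [inf set0] is 0, so the left side would be everything for empty [K] and
    positive [eps], while the thickening is empty. *)
Lemma dist_to_lt K eps : K !=set0 ->
  [set x | dist_to K x < eps] = thickening K eps.
Proof.
move=> K0; apply/seteqP; split => x /=.
  move=> /inf_lt[|_ [y Ky <-] xy]; last by exists y.
  by case: K0 => y Ky; exists (mdist x y), y.
move=> [y Ky xy]; apply: le_lt_trans xy; apply: ge_inf; last by exists y.
by exists 0 => _ [z _ <-]; exact: mdist_ge0.
Qed.

Lemma thickeningS K L eps : K `<=` L -> thickening K eps `<=` thickening L eps.
Proof. by move=> KL x [y /KL Ly xy]; exists y. Qed.

Lemma thickening_thickening K L eps eps' : K `<=` thickening L eps' ->
  thickening K eps `<=` thickening L (eps' + eps).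
Proof.
move=> KL x [y /KL[z Lz yz] xy]; exists z => //.
by rewrite addrC (le_lt_trans (metric_triangle x y z))// ltrD.
Qed.

Lemma sub_thickening K eps : 0 < eps -> K `<=` thickening K eps.
Proof. by move=> e0 x Kx; exists x; rewrite // mdistxx. Qed.

Lemma open_thickening K eps : open (thickening K eps).
Proof.
rewrite openE => x [y Ky xy]; apply/nbhs_ballP.
exists (eps - mdist x y) => /=; first by rewrite subr_gt0.
move=> z; rewrite ballEmdist/= ltrBrDr metric_sym => zx; exists y => //.
exact: le_lt_trans (metric_triangle z x y) zx.
Qed.

Lemma thickening_meets_ball K eps x : 0 < eps ->
  (forall B, nbhs x B -> thickening K eps `&` B !=set0) ->
  thickening K (eps + eps) x.
Proof.
move=> e0 /(_ (ball x eps) (nbhsx_ballx x eps e0))[z [[y Ky zy] xz]].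
exists y => //; rewrite ballEmdist/= in xz.
by rewrite (le_lt_trans (metric_triangle x z y))// ltrD.
Qed.

Lemma closed_thickeningP K x : closed K ->
  (forall eps, 0 < eps -> thickening K eps x) -> K x.
Proof.
move=> cK Kx; apply: cK => B /nbhs_ballP[eps /= e0 eB].
have [y Ky xy] := Kx eps e0; exists y; split => //.
by apply: eB; rewrite ballEmdist.
Qed.

End thickening.

(** If every [C i] left [U], the sets [C i]\[U] would generate a proper filter. Its cluster point,
    given by compactness, lies in every closure, hence in [U], which is then a neighbourhood missing
    all these sets. *)
Lemma directed_sub_open (T : topologicalType) I (D : set I) (C : I -> set T)
    (U : set T) : compact [set: T] -> D !=set0 ->
  (forall i j, D i -> D j -> exists2 k, D k & C k `<=` C i `&` C j) ->
  open U -> \bigcap_(i in D) closure (C i) `<=` U ->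
  exists2 i, D i & C i `<=` U.
Proof.
move=> cT D0 dirC oU CU; apply: contrapT => nCU.
pose F := filter_from D (fun i => C i `\` U).
have FF : Filter F.
  apply: filter_from_filter => // i j Di Dj.
  have [k Dk kij] := dirC i j Di Dj; exists k => // x [/kij[Cix Cjx] nUx].
  by split.
have PF : ProperFilter F.
  apply: filter_from_proper => i Di; apply: contrapT => CiU.
  apply: nCU; exists i => // x Cix; apply: contrapT => nUx.
  by apply: CiU; exists x.
have [x [_ xF]] := cT F PF filterT.
have Ux : U x.
  apply: CU => i Di B xB.
  have [y [[Ciy _] By]] := xF _ _ (ex_intro2 _ _ i Di (@subset_refl _ _)) xB.
  by exists y.
have [i Di] := D0.
have [y [[_ nUy] Uy]] :=
  xF _ U (ex_intro2 _ _ i Di (@subset_refl _ _)) (open_nbhs_nbhs (conj oU Ux)).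
exact: nUy Uy.
Qed.

Lemma thickeningI_sub_open {R : realType} {M : pmetricType R}
    (K L U : set M) : compact [set: M] -> closed K -> closed L -> open U ->
  K `&` L `<=` U ->
  exists2 eps : R, 0 < eps & thickening K eps `&` thickening L eps `<=` U.
Proof.
move=> cM cK cL oU KLU.
apply: (@directed_sub_open M R [set e | 0 < e]
  (fun e => thickening K e `&` thickening L e)) => //.
- by exists 1 => /=.
- move=> a b /= a0 b0; exists (Order.min a b); first by rewrite lt_min a0.
  move=> x [[y Ky +] [z Lz +]]; rewrite !lt_min => /andP[xya xyb] /andP[xza xzb].
  by split; split; [exists y|exists z|exists y|exists z].
- move=> x xKL; apply: KLU.
  (* Halving the radius absorbs the closure: a point adherent to the [e / 2]-thickening lies in the
     [e]-thickening. *)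
  have half e : 0 < e -> thickening K e x /\ thickening L e x.
    move=> e0; have e20 : 0 < e / 2 by rewrite divr_gt0.
    rewrite [e]splitr; split; apply: thickening_meets_ball => // B /(xKL _ e20).
      by move=> [y [[Ky _] By]]; exists y.
    by move=> [y [[_ Ly] By]]; exists y.
  by split; apply: closed_thickeningP => // e /half[].
Qed.

(** * Basins expressed through visit frequencies *)

Section basin_theory.
Context {R : realType} {M : pmetricType R} (f : M -> M).
Implicit Types (K L : set M).

Lemma basinE K : K !=set0 ->
  basin f K = [set x | forall eps : R, 0 < eps ->
    full_freq (R := R) f (thickening K eps) x].
Proof.
move=> K0.
suff visitsE eps x n :
    n%:R^-1 * (visits f K eps x n)%:R = visit_freq f (thickening K eps) x n :> R.
  apply/seteqP; split => x Kx eps e0; have := Kx eps e0; rewrite /full_freq/=.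
    by under eq_fun do rewrite visitsE.
  by under [X in _ -> X @ _ --> _]eq_fun do rewrite visitsE.
rewrite /visits /visit_freq -sum1_card natr_sum big_mkcond/=; congr *%R.
apply: eq_bigr => j _; rewrite indicE -(dist_to_lt _ K0).
have -> : (iter j f x \in [set y | dist_to K y < eps])
    = (dist_to K (iter j f x) < eps) by apply/idP/idP; rewrite inE.
by rewrite inE; case: ifP.
Qed.

Lemma basinS K L : K !=set0 -> K `<=` L -> basin f K `<=` basin f L.
Proof.
move=> K0 KL; have L0 : L !=set0 by case: K0 => x /KL; exists x.
rewrite !basinE// => x Kx eps e0.
by apply: full_freqS (Kx eps e0); exact: thickeningS.
Qed.

Lemma basinT : basin f setT = setT.
Proof.
rewrite basinE; last by exists point.
apply/seteqP; split => // x _ eps e0.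
have -> : thickening setT eps = setT :> set M.
  by apply/seteqP; split => // y _; exact: sub_thickening.
by rewrite full_freqT.
Qed.

(** A common point of the basins visits every open set around [K]&[L] with frequency 1. Were [K]&[L]
    empty, [set0] would be such an open set, yet it is never visited. *)
Lemma basinI K L : compact [set: M] -> closed K -> closed L ->
    K !=set0 -> L !=set0 -> basin f K `&` basin f L !=set0 ->
  K `&` L !=set0 /\ basin f K `&` basin f L `<=` basin f (K `&` L).
Proof.
move=> cM cK cL K0 L0 [x0 KLx0].
have KL U x : open U -> K `&` L `<=` U -> (basin f K `&` basin f L) x ->
    full_freq (R := R) f U x.
  rewrite !basinE// => oU KLU [Kx Lx].
  have [eps e0 epsU] := thickeningI_sub_open cM cK cL oU KLU.
  apply: (full_freqS epsU); apply: full_freqI.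
  by split; [exact: Kx|exact: Lx].
have KL0 : K `&` L !=set0.
  apply/set0P/eqP => KL0.
  by have := KL set0 x0 open0; rewrite KL0 full_freq0; apply.
split => // x KLx; rewrite basinE// => eps e0.
by apply: KL KLx; [exact: open_thickening|exact: sub_thickening].
Qed.

(** Half of [eps] bounds the distance from [C k] to [K], the other half that from the orbit to
    [C k]. This reduces [K] to countably many sets. *)
Lemma bigcap_basin_sub K (C : nat -> set M) :
    K !=set0 -> (forall k, C k !=set0) ->
    (forall k, C k `<=` thickening K k.+1%:R^-1) ->
  \bigcap_k basin f (C k) `<=` basin f K.
Proof.
move=> K0 C0 CK x Cx; rewrite basinE// => eps e0.
have e20 : 0 < eps / 2 by rewrite divr_gt0.
have [k] := ltr_add_invr e20; rewrite add0r => /ltW ke.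
have := Cx k I; rewrite basinE// => /(_ _ e20).
apply: full_freqS => y /(thickening_thickening (CK k))[z Kz yz].
exists z => //; apply: lt_le_trans yz _.
by rewrite [leRHS]splitr lerD.
Qed.

(** By monotonicity the radii [k.+1%:R^-1] suffice, and thickenings are open, hence Borel. *)
Lemma measurable_basin K :
    measurable_fun [set: borel M] (f : borel M -> borel M) -> K !=set0 ->
  measurable (basin f K : set (borel M)).
Proof.
move=> mf K0.
rewrite (_ : basin f K = \bigcap_k
    full_freq (R := R) f (thickening K k.+1%:R^-1)).
  apply: bigcapT_measurable => k; apply: measurable_full_freq => //.
  by apply: sub_sigma_algebra; exact: open_thickening.
rewrite basinE//; apply/seteqP; split => x Kx.
  by move=> k _; apply: Kx; rewrite invr_gt0.
move=> eps e0; have [k] := ltr_add_invr e0; rewrite add0r => ke.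
apply: full_freqS (Kx k I) => y [z Kz yz]; exists z => //.
exact: lt_trans yz ke.
Qed.

End basin_theory.

(** * Countable and almost sure intersections *)

Lemma measure_bigcap_ge d (T : measurableType d) (R : realType)
    (m : probability T R) (alpha : \bar R) (B : nat -> set T) :
  (forall k, measurable (B k)) ->
  (forall n, (alpha <= m (\bigcap_(k < n) B k))%E) ->
  (alpha <= m (\bigcap_k B k))%E.
Proof.
(* The finite intersections [E n] decrease to the full one, starting from the whole space at
   [n = 0]. *)
move=> mB Balpha; pose E n := \bigcap_(k < n) B k.
have mE n : measurable (E n) by exact: bigcap_measurableType.
have EB : \bigcap_n E n = \bigcap_k B k.
  apply/seteqP; split => x Ex k _; first exact: (Ex k.+1 I k (ltnSn k)).
  by move=> i _; exact: Ex.
have mcvg : m \o E @ \oo --> m (\bigcap_n E n).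
  apply: nonincreasing_cvg_mu => //.
  - by rewrite (le_lt_trans (probability_le1 m (mE 0%N)))// ltry.
  - exact: bigcapT_measurable.
  - move=> i j ij; apply/subsetPset => x Ex k /= ki.
    by apply: Ex; exact: leq_trans ki ij.
rewrite -EB -(cvg_lim (@ereal_hausdorff R) mcvg)//.
apply: lime_ge; first by apply/cvg_ex; eexists; exact: mcvg.
exact: nearW.
Qed.

(** The complement of the intersection is a union of two null sets. *)
Lemma probability_setI_eq1 d (T : measurableType d) (R : realType)
    (m : probability T R) (A B : set T) : measurable A -> measurable B ->
  (1 <= m A)%E -> (1 <= m B)%E -> m (A `&` B) = 1%E.
Proof.
move=> mA mB A1 B1.
have mC0 C : measurable C -> (1 <= m C)%E -> m (~` C) = 0%E.
  move=> mC C1; rewrite probability_setC// (_ : m C = 1%E) ?subee//.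
  by apply/eqP; rewrite eq_le C1 probability_le1.
rewrite -[A `&` B]setCK probability_setC; last first.
  by apply: measurableC; exact: measurableI.
rewrite setCI measureU0; [|exact: measurableC|exact: measurableC|exact: mC0].
by rewrite -[RHS]sube0; congr (_ - _)%E; exact: mC0.
Qed.

(** * Existence by Zorn's lemma, and uniqueness *)

Section minimal.
Context {R : realType} {M : pmetricType R}.
Context (m : probability (borel M) R) (f : M -> M) (cM : compact [set: M])
  (mf : measurable_fun [set: borel M] (f : borel M -> borel M)).
Implicit Types (K L : set M) (alpha : R).

Lemma observable_closed alpha K : observable m f alpha K -> closed K.
Proof.
by move=> [_ cK _]; apply: compact_closed cK; exact: metric_hausdorff.
Qed.

(* Chains are described by complements, to match [Zorn_bigcup]. *)
Lemma observable_chain alpha (F : set (set M)) : alpha <= 1 ->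
    F `<=` [set U | observable m f alpha (~` U)] -> total_on F subset ->
  observable m f alpha (~` \bigcup_(X in F) X).
Proof.
move=> a1 Fobs Ftot.
(* The empty chain is bounded by the whole space, whose basin is everything; this is where
   [alpha <= 1] enters. *)
have [F0|/set0P F0] := eqVneq F set0.
  rewrite F0 bigcup_set0 setC0; split => //; first by exists point.
  by rewrite basinT probability_setT lee_fin.
pose K := ~` \bigcup_(X in F) X.
have FC X : F X -> closed (~` X) by move=> /Fobs/observable_closed.
have KE : K = \bigcap_(X in F) ~` X by rewrite /K setC_bigcup.
(* By compactness, every open set around [K] already contains a member of the chain of
   complements. *)
have sub U : open U -> K `<=` U -> exists2 X, F X & ~` X `<=` U.
  move=> oU KU; apply: (@directed_sub_open M _ F setC U cM F0) => //.
    move=> X Y FX FY.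
    by case: (Ftot X Y FX FY) => XY; [exists Y|exists X] => // x nx;
      split=> // /XY.
  apply: subset_trans KU; rewrite KE => x Kx X FX.
  by have := Kx X FX; rewrite -((closure_id _).1 (FC X FX)).
have K0 : K !=set0.
  apply/set0P/eqP => KE0.
  have [X FX] := sub set0 open0 (ltac:(by rewrite KE0)).
  by case: (Fobs X FX) => -[x Xx] _ _ /(_ x Xx).
split => //.
  apply: subclosed_compact cM _ => //.
  by rewrite -/K KE; apply: closed_bigI => X; exact: FC.
(* The chain may be uncountable; a sequence extracted from it brings the problem within reach of
   continuity from above. *)
have /choice[X XP] k : exists X, F X /\ ~` X `<=` thickening K k.+1%:R^-1.
  have [|X FX XK] := sub (thickening K (k.+1%:R^-1 : R)) (open_thickening _ _).
    by apply: sub_thickening; rewrite invr_gt0.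
  by exists X.
have obsX k : observable m f alpha (~` X k) by apply: Fobs; case: (XP k).
have X0 k : ~` X k !=set0 by case: (obsX k).
have mB k := measurable_basin mf (X0 k).
apply: (@le_trans _ _ (m (\bigcap_k basin f (~` X k)))); last first.
  apply: le_measure; rewrite ?inE.
  - exact: bigcapT_measurable.
  - exact: measurable_basin.
  - by apply: bigcap_basin_sub => // k; case: (XP k).
apply: measure_bigcap_ge => // n.
(* Finitely many members of a chain have a largest one; the basin of its complement lies in the
   finite intersection of basins and has measure at least [alpha]. *)
have [Y FY YX] : exists2 Y, F Y & forall k, (k < n)%N -> X k `<=` Y.
  elim: n => [|n [Y FY YX]]; first by have [Y FY] := F0; exists Y.
  have FXn : F (X n) by case: (XP n).
  case: (Ftot Y (X n) FY FXn) => YXn; [exists (X n)|exists Y] => // k;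
    rewrite ltnS leq_eqVlt => /predU1P[->//|/YX XY] //.
  exact: subset_trans XY YXn.
have [Y0 _ Ya] := Fobs Y FY; apply: (le_trans Ya).
apply: le_measure; rewrite ?inE; first exact: measurable_basin.
  exact: bigcap_measurableType.
by move=> x Yx k kn; apply: basinS Yx => //; apply: subsetC; exact: YX.
Qed.

Lemma exists_minimal_observable alpha : alpha <= 1 ->
  exists K, minimal_observable m f alpha K.
Proof.
move=> a1.
have [U [Uobs Umax]] := Zorn_bigcup (fun F => @observable_chain alpha F a1).
exists (~` U); split => // K' K'0 cK' K'U K'obs.
(* A smaller observable set [K'] would have a complement strictly above the maximal [U]. *)
apply: (Umax (~` K')); last by rewrite /= setCK.
case: K'U => K'U UK'; split=> [x Ux /K'U/(_ Ux)//|K'cU].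
by apply: UK' => x nUx; apply: contrapT => /K'cU.
Qed.

Lemma minimal_observable1_unique K L :
  minimal_observable m f 1 K -> minimal_observable m f 1 L -> K = L.
Proof.
move=> [Kobs Kmin] [Lobs Lmin].
have [K0 cK K1] := Kobs; have [L0 cL L1] := Lobs.
have mK := measurable_basin mf K0; have mL := measurable_basin mf L0.
have KL1 := probability_setI_eq1 mK mL K1 L1.
(* An intersection of measure 1 is nonempty, which supplies the common point that [basinI]
   requires. *)
have B0 : basin f K `&` basin f L !=set0.
  apply/set0P/eqP => E; move: KL1; rewrite E measure0 => /eqP.
  by rewrite eq_sym onee_eq0.
have [KL0 KLb] :=
  basinI cM (observable_closed Kobs) (observable_closed Lobs) K0 L0 B0.
have KLobs : observable m f 1 (K `&` L).
  split => //; first exact: compact_closedI cK (observable_closed Lobs).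
  rewrite -KL1; apply: le_measure; rewrite ?inE//; first exact: measurableI.
  exact: measurable_basin.
have [_ cKL _] := KLobs.
have KE : K `&` L = K.
  apply: contrapT => neq; apply: (Kmin _ KL0 cKL _ KLobs).
  by rewrite properEneq; split; [exact/eqP|exact: subIsetl].
have LE : K `&` L = L.
  apply: contrapT => neq; apply: (Lmin _ KL0 cKL _ KLobs).
  by rewrite properEneq; split; [exact/eqP|exact: subIsetr].
by rewrite -KE LE.
Qed.

End minimal.

Theorem theorem1p10 (R : realType) (M : pmetricType R) (n : nat)
    (X : riemannian_data M n) (hX : is_riemannian_manifold X)
    (hM : compact [set: M])
    (m : probability (borel M) R) (hm : is_normalized_volume X m)
    (f : M -> M)
    (hf : measurable_fun [set: borel M] (f : borel M -> borel M)) :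
  (forall alpha : R, 0 < alpha <= 1 ->
     exists K : set M,
       statistical_attractor m f K /\ minimal_observable m f alpha K) /\
  (forall K K' : set M,
     statistical_attractor m f K -> minimal_observable m f 1 K ->
     statistical_attractor m f K' -> minimal_observable m f 1 K' -> K = K').
Proof.
split => [alpha /andP[a0 a1]|K K' _ Kmin _ K'min].
  have [K Kmin] := exists_minimal_observable m hM hf a1.
  have [[K0 cK Ka] _] := Kmin.
  (* Positivity of [alpha] makes an observable set a statistical attractor. *)
  by exists K; split => //; split => //; apply: lt_le_trans Ka; rewrite lte_fin.
exact: (minimal_observable1_unique hM hf Kmin K'min).
Qed.
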